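(* Let $A$ and $B$ be posets and $\mathcal{X}\subseteq\mathcal{P}A$ a collection of subsets of $A$. The mutually inverse isomorphisms $f\mapsto T_f$ and $T\mapsto f_T$ between the posets $Ant(A,B)$ and $A\otimes_r B$ induce (by restriction) mutually inverse isomorphisms between the posets $Ant_{\mathcal{X}}(A,B)$ and $A_{\mathcal{X}}\otimes B$.
   Context: $Ant(A,B)$ is the pointwise ordered set of all antitone (order-reversing) maps from $A$ to $B$. $A\otimes_r B$ is the set, ordered by inclusion, of all down-sets $T$ of $A\times B$ (componentwise order) such that for each $x\in A$, $xT=\{y\in B:(x,y)\in T\}$ is a principal ideal of $B$. The assignments are $T_f=\{(x,y)\in A\times B: f(x)\ge y\}$ and $f_T(x)=\max xT$. For $X\subseteq A$, $\Delta X=\bigcap\{\downarrow a: X\subseteq\downarrow a\}$ (intersection over all principal ideals containing $X$; $A$ if there are none). An $\mathcal{X}$-ideal of $A$ is a subset $I$ with $\Delta X\subseteq I$ for all $X\in\mathcal{X}\cup\{\{x\}:x\in A\}$ with $X\subseteq I$. $Ant_{\mathcal{X}}(A,B)$ is the pointwise ordered set of all maps $f:A\to B$ such that for each $y\in B$, $f^{-1}[\uparrow y]=\{x: f(x)\ge y\}$ is an $\mathcal{X}$-ideal. $A_{\mathcal{X}}\otimes B$ is the set, ordered by inclusion, of all $T\subseteq A\times B$ such that for each $x\in A$, $xT$ is a principal ideal of $B$, and for each $y\in B$, $Ty=\{x\in A:(x,y)\in T\}$ is an $\mathcal{X}$-ideal of $A$. *)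

(* Defs.v *)
From mathcomp Require Import all_boot all_order.
From mathcomp Require Import all_classical.

Set Implicit Arguments.
Unset Strict Implicit.
Unset Printing Implicit Defensive.

Import Order.TTheory.

Local Open Scope classical_set_scope.
Local Open Scope order_scope.

Section Ideals.
Context {d : Order.disp_t} {A : porderType d}.
Implicit Types (X I : set A) (XX : set (set A)) (a m : A).

Definition pideal a : set A := down [set a].

Definition principal_ideal I : Prop := exists a, I = pideal a.

Definition is_max I m : Prop := I m /\ ubound I m.

Lemma principal_ideal_max I : principal_ideal I -> exists m, is_max I m.
Proof.
move=> [a ->]; exists a; split; first by exists a; split.
by move=> x [_ [->]].
Qed.

(* The intersection is [setT] when no principal ideal contains [X]. *)
Definition Delta X : set A :=
  \bigcap_(a in [set a | X `<=` pideal a]) pideal a.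

Definition X_ideal XX I : Prop :=
  forall X, (XX `|` range (fun x : A => [set x])) X -> X `<=` I ->
    Delta X `<=` I.

End Ideals.

Section Tensor.
Context {dA dB : Order.disp_t} (A : porderType dA) (B : porderType dB).
Implicit Types (XX : set (set A)) (f : A -> B) (T : set (A * B)).

Definition Ant : set (A -> B) := [set f | {homo f : x y /~ x <= y}].

Definition Ant_X XX : set (A -> B) :=
  [set f | forall y : B, X_ideal XX (f @^-1` [set b | y <= b])].

Definition principal_rows : set (set (A * B)) :=
  [set T | forall x, principal_ideal (xsection T x)].

(* [A *p B] is [A * B] with the componentwise order. *)
Definition tensor_r : set (set (A * B)) :=
  [set T | (forall p q : A *p B, q <= p -> T p -> T q) /\ principal_rows T].

Definition tensor_X XX : set (set (A * B)) :=
  [set T | principal_rows T /\ forall y, X_ideal XX (ysection T y)].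

Definition T_of f : set (A * B) := [set p | p.2 <= f p.1].

(* [max xT] only makes sense when the rows of [T] are principal ideals ([B]
   need not have any default element), hence the proof argument. *)
Definition f_of T (hT : principal_rows T) : A -> B :=
  fun x => sval (cid (principal_ideal_max (hT x))).

End Tensor.

Arguments Ant {dA dB} A B _.
Arguments Ant_X {dA dB} A B XX _.
Arguments principal_rows {dA dB} A B _.
Arguments tensor_r {dA dB} A B _.
Arguments tensor_X {dA dB} A B XX _.
Arguments T_of {dA dB} A B f _.
Arguments f_of {dA dB} A B T hT x.

(* [phi : P -> Q] and the partial map [psi], defined on [D], restrict to
   mutually inverse order isomorphisms between the subposets [U] of [P] and
   [V] of [Q]. *)
Record inverse_isos {dP dQ : Order.disp_t} {P : porderType dP}
    {Q : porderType dQ} (D : set Q) (phi : P -> Q)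
    (psi : forall q : Q, D q -> P) (U : set P) (V : set Q) : Prop := {
  iso_dom : V `<=` D ;
  iso_fun : forall p, U p -> V (phi p) ;
  iso_inv_fun : forall q (hq : D q), V q -> U (psi q hq) ;
  iso_funK : forall p (hp : D (phi p)), U p -> psi (phi p) hp = p ;
  iso_invK : forall q (hq : D q), V q -> phi (psi q hq) = q ;
  iso_mono : forall p p', U p -> U p' -> (phi p <= phi p') = (p <= p') ;
  iso_inv_mono : forall q q' (hq : D q) (hq' : D q'), V q -> V q' ->
    (psi q hq <= psi q' hq') = (q <= q')
}.

(* Main.v *)
Require Import Defs.
From mathcomp Require Import all_boot all_order.
From mathcomp Require Import all_classical.
Import Order.TTheory.

(** Everything rests on one Galois-type equivalence: [T (x, y)] holds iff
    [y <= f x], where [f] is the map picking the maximum of each row of [T]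
    ([le_f_of]).  For [T := T_of f] it says that the row of [T] at [x] is the
    principal ideal of [f x] ([xsection_T_of]) and that its column at [y] is
    the preimage under [f] of the principal filter of [y] ([ysection_T_of]).
    Hence [f |-> T_of f] is an isomorphism from the poset of all maps
    [A -> B] onto the poset of all relations with principal rows ([f_ofK],
    [le_T_of]).  It therefore restricts to an isomorphism between a class of
    maps and a class of relations as soon as membership in the two classes
    corresponds along [T_of] ([inverse_isos_T_of]).

    For antitone maps and down-sets, this correspondence is transitivity of
    the order; for [Ant_X] and [tensor_X] it is the description of columns,
    both classes being defined by requiring the same subsets of [A] to be
    ideals.  The inclusions [Ant_X `<=` Ant] and [tensor_X `<=` tensor_r] come
    from the singletons in the definition of an ideal: they force it to be a
    down-set ([X_ideal_le]). *)

Local Open Scope classical_set_scope.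
Local Open Scope order_scope.

Section Ideals.
Context {d : Order.disp_t} {A : porderType d}.
Implicit Types (x y a : A) (I : set A) (XX : set (set A)).

Lemma pidealE a x : pideal a x <-> x <= a.
Proof. by split=> [[_ [->]]|xa] //; exists a. Qed.

(** Every principal ideal containing [x] contains [y] when [y <= x], so [y]
    lies in [Delta [set x]]. *)
Lemma X_ideal_le XX I x y : X_ideal XX I -> I x -> y <= x -> I y.
Proof.
move=> idI Ix yx; apply: (idI [set x]).
- by right; exists x.
- by move=> _ ->.
- move=> a xa; apply/pidealE/(le_trans yx).
  by apply/pidealE; exact: xa.
Qed.

End Ideals.

Section Correspondence.
Context {dA dB : Order.disp_t} {A : porderType dA} {B : porderType dB}.
Implicit Types (f g : A -> B) (T S : set (A * B)) (XX : set (set A)).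

Lemma xsection_T_of f x : xsection (T_of A B f) x = pideal (f x).
Proof.
apply/seteqP; split=> y; first by move=> /xsectionP/pidealE.
by move=> /pidealE yf; apply/xsectionP.
Qed.

Lemma ysection_T_of f y :
  ysection (T_of A B f) y = f @^-1` [set b | y <= b].
Proof. by rewrite ysectionE. Qed.

Lemma principal_rows_T_of f : principal_rows A B (T_of A B f).
Proof. by move=> x; exists (f x); exact: xsection_T_of. Qed.

Lemma le_f_of T (hT : principal_rows A B T) x y :
  y <= f_of A B T hT x <-> T (x, y).
Proof.
rewrite /f_of; case: cid => m /= [Tm ubm].
have [b rowE] := hT x.
split=> [ym|Txy]; last by apply/ubm/xsectionP.
apply/xsectionP; move: Tm; rewrite rowE => /pidealE mb.
by apply/pidealE/(le_trans ym).
Qed.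

Lemma f_ofK T (hT : principal_rows A B T) : T_of A B (f_of A B T hT) = T.
Proof. by apply/seteqP; split=> -[x y] /(le_f_of T hT). Qed.

(** Taking [y := f x] shows that [f] can be recovered from [T_of f], order
    included. *)
Lemma le_T_of f g : (T_of A B f <= T_of A B g) = (f <= g).
Proof.
apply/idP/idP => [/subsetPset fg|/lefP fg].
- by apply/lefP => x; exact: (fg (x, f x) (lexx _)).
- by apply/subsetPset => -[x y] /= yf; exact: le_trans yf (fg x).
Qed.

Lemma T_of_inj : injective (T_of A B).
Proof. by move=> f g fg; apply/le_anti; rewrite -!le_T_of fg lexx. Qed.

Lemma inverse_isos_T_of (U : set (A -> B)) (V : set (set (A * B))) :
  V `<=` principal_rows A B -> (forall f, U f <-> V (T_of A B f)) ->
  inverse_isos (T_of A B) (f_of A B) U V.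
Proof.
move=> Vrows UV; split=> //.
- by move=> f /UV.
- by move=> T hT VT; apply/UV; rewrite f_ofK.
- by move=> f hf _; apply: T_of_inj; exact: f_ofK.
- by move=> T hT _; exact: f_ofK.
- by move=> f g _ _; exact: le_T_of.
- by move=> T S hT hS _ _; rewrite -le_T_of !f_ofK.
Qed.

Lemma Ant_T_of f : Ant A B f <-> tensor_r A B (T_of A B f).
Proof.
split=> [anti|[down _] x y yx].
- split; last exact: principal_rows_T_of.
  move=> [x y] [x' y'] /andP[/= x'x y'y] yf.
  exact: le_trans (le_trans y'y yf) (anti _ _ x'x).
- apply: (down (x, f x) (y, f x)) => /=; last exact: lexx.
  by apply/andP; split.
Qed.

Lemma Ant_X_T_of XX f : Ant_X A B XX f <-> tensor_X A B XX (T_of A B f).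
Proof.
split=> [idf|[_ idf] y]; last by rewrite -ysection_T_of.
by split=> [|y]; [exact: principal_rows_T_of|rewrite ysection_T_of].
Qed.

Lemma Ant_X_sub_Ant XX : Ant_X A B XX `<=` Ant A B.
Proof.
move=> f idf x y yx.
by apply: (X_ideal_le _ _ _ _ (idf (f x)) _ yx) => /=.
Qed.

(** Every relation with principal rows is some [T_of f], so the inclusion
    for maps transfers to relations. *)
Lemma tensor_X_sub_tensor_r XX : tensor_X A B XX `<=` tensor_r A B.
Proof.
move=> T TX; have [hT _] := TX; move: TX.
by rewrite -(f_ofK T hT) => /Ant_X_T_of/Ant_X_sub_Ant/Ant_T_of.
Qed.

End Correspondence.

Theorem proposition5p1 (dA dB : Order.disp_t) (A : porderType dA)
    (B : porderType dB) (XX : set (set A)) :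
  [/\ inverse_isos (T_of A B) (f_of A B) (Ant A B) (tensor_r A B),
      Ant_X A B XX `<=` Ant A B,
      tensor_X A B XX `<=` tensor_r A B
    & inverse_isos (T_of A B) (f_of A B) (Ant_X A B XX) (tensor_X A B XX)].
Proof.
split.
- by apply: inverse_isos_T_of => [T []|f] //; exact: Ant_T_of.
- exact: Ant_X_sub_Ant.
- exact: tensor_X_sub_tensor_r.
- by apply: inverse_isos_T_of => [T []|f] //; exact: Ant_X_T_of.
Qed.
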